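(* Let $\lambda_A,\lambda_B,\lambda_C>0$ and $\lambda^*=\lambda_A+\lambda_B+\lambda_C$. Let $f:[0,\lambda^* )\to[0,\lambda^* )$ be the interval exchange transformation on the alphabet $\mathcal{A}=\{A,B,C\}$ with length data $(\lambda_A,\lambda_B,\lambda_C)$ and combinatorial data $\pi_0(A)=1,\ \pi_0(B)=2,\ \pi_0(C)=3$ and $\pi_1(A)=3,\ \pi_1(B)=2,\ \pi_1(C)=1$. Then the sequence $(f^n(y))_{n\ge 0}$ is a low-discrepancy sequence in $[0,\lambda^* )$ for all $y\in[0,\lambda^* )$ if and only if the number $z=\frac{\lambda_B+\lambda_C}{\lambda^*+\lambda_B}$ is irrational and, writing its continued fraction expansion as $z=[a_0;a_1,a_2,\ldots]$, the sequence of moving averages $a_m^{(1)}=\frac1m\sum_{j=1}^m a_j$, $m\ge 1$, is bounded.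
   Context: Interval exchange transformation: let $\mathcal{A}$ be a finite alphabet with $n$ elements, $\pi_0,\pi_1:\mathcal{A}\to\{1,\ldots,n\}$ bijections (combinatorial data), $\lambda_\alpha>0$ for $\alpha\in\mathcal{A}$ (length data) and $\lambda^*=\sum_{\alpha}\lambda_\alpha$. Partition $[0,\lambda^* )$ into the intervals $I_\alpha=\bigl[\sum_{\pi_0(\beta)<\pi_0(\alpha)}\lambda_\beta,\ \lambda_\alpha+\sum_{\pi_0(\beta)<\pi_0(\alpha)}\lambda_\beta\bigr)$. The corresponding interval exchange transformation is $f(x)=x+w_\alpha$ for $x\in I_\alpha$, where $w_\alpha=\sum_{\pi_1(\beta)<\pi_1(\alpha)}\lambda_\beta-\sum_{\pi_0(\beta)<\pi_0(\alpha)}\lambda_\beta$. Thus $\pi_0$ and $\pi_1$ give the positions of the intervals before and after applying $f$. Low discrepancy: for a sequence $S=(\omega_n)_{n\ge0}$ in a bounded interval $I=[a,b)$, $a<b$, the star-discrepancy of its first $N$ points is $D_{N,I}^*(S)=\sup_{a<t<b}\left|\frac{A_N([a,t),S)}{N}-\frac{t-a}{b-a}\right|$, where $A_N(B,S)=\#\{n: 0\le n<N,\ \omega_n\in B\}$. The sequence $S$ is a low-discrepancy sequence in $I$ if $D_{N,I}^*(S)=O(N^{-1}\log N)$ as $N\to\infty$. *)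

(* Defs.v *)
From HB Require Import structures.
From mathcomp Require Export all_boot all_order all_algebra.
From mathcomp Require Export all_classical all_reals all_analysis.

Set Implicit Arguments.
Unset Strict Implicit.
Unset Printing Implicit Defensive.

Import Order.TTheory GRing.Theory Num.Theory.
Import numFieldNormedType.Exports.

Local Open Scope classical_set_scope.
Local Open Scope ring_scope.

Section IntervalExchange.
Variables (R : realType) (Alph : finType).
(* pi0 and pi1 are intended to be bijections onto {1, ..., #|Alph|}. *)
Variables (pi0 pi1 : Alph -> nat) (lam : Alph -> R).

Definition iet_left (p : Alph -> nat) (a : Alph) : R :=
  \sum_(b | (p b < p a)%N) lam b.

Definition iet_interval (a : Alph) : interval R :=
  `[iet_left pi0 a, lam a + iet_left pi0 a[.

Definition iet_shift (a : Alph) : R := iet_left pi1 a - iet_left pi0 a.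

(* The intervals partition [0, \sum_a lam a[; outside it the map is extended
   by the identity, a value irrelevant to orbits starting inside. *)
Definition iet (x : R) : R :=
  if [pick a | x \in iet_interval a] is Some a then x + iet_shift a else x.

End IntervalExchange.

Section Discrepancy.
Variable R : realType.

Definition visits (S : nat -> R) (B : set R) (N : nat) : nat :=
  #|[pred n : 'I_N | S n \in B]|.

(* For a < b and 0 < N the set is nonempty and bounded by 1, so this real sup
   is the genuine supremum. *)
Definition star_discrepancy (a b : R) (S : nat -> R) (N : nat) : R :=
  sup [set `|(visits S `[a, t[ N)%:R / N%:R - (t - a) / (b - a)|
      | t in `]a, b[ ].

Definition low_discrepancy (a b : R) (S : nat -> R) : Prop :=
  (forall n, S n \in `[a, b[) /\
  star_discrepancy a b S =O_\oo (fun N => N%:R^-1 * ln N%:R).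

End Discrepancy.

Section ContinuedFraction.
Variable R : realType.

(* Complete quotients z_0 = z, z_(j+1) = 1 / (z_j - floor z_j); for irrational
   z no denominator vanishes and the partial quotients are a_j = floor z_j. *)
Fixpoint complete_quotient (z : R) (j : nat) : R :=
  if j is j'.+1 then
    (complete_quotient z j' - (Num.floor (complete_quotient z j'))%:~R)^-1
  else z.

Definition partial_quotient (z : R) (j : nat) : int :=
  Num.floor (complete_quotient z j).

Definition quotient_average (z : R) (m : nat) : R :=
  (\sum_(1 <= j < m.+1) (partial_quotient z j)%:~R) / m%:R.

End ContinuedFraction.

Inductive letter := LetA | LetB | LetC.

Definition letter_to_ord (l : letter) : 'I_3 :=
  match l with LetA => inord 0 | LetB => inord 1 | LetC => inord 2 end.

Definition ord_to_letter (i : 'I_3) : letter :=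
  match val i with 0 => LetA | 1 => LetB | _ => LetC end.

Lemma letter_to_ordK : cancel letter_to_ord ord_to_letter.
Proof. by case; rewrite /ord_to_letter /= inordK. Qed.

HB.instance Definition _ := Countable.copy letter (can_type letter_to_ordK).

Lemma letter_enumP : Finite.axiom [:: LetA; LetB; LetC].
Proof.
have E (x y : letter) : (x == y) = (letter_to_ord x == letter_to_ord y) by [].
by case; rewrite /= !E /= -!val_eqE /= !inordK.
Qed.

HB.instance Definition _ := fintype.isFinite.Build letter letter_enumP.

Definition letter_data (T : Type) (tA tB tC : T) (l : letter) : T :=
  match l with LetA => tA | LetB => tB | LetC => tC end.

(* Main.v *)
Require Import Defs.
From mathcomp Require Import all_boot all_order all_algebra.
From mathcomp Require Import all_classical all_reals all_analysis.
From mathcomp Require Import zify ring lra.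
Import Order.TTheory GRing.Theory Num.Theory.
Import numFieldNormedType.Exports.
Local Open Scope classical_set_scope.
Local Open Scope ring_scope.

(** The exchange of three intervals with reversed order is a first-return map
of a rotation.  Put L = lA + 2 lB + lC and alpha = lB + lC, and rotate [0, L)
by alpha: points of the first and third intervals land where the exchange
sends them, while points of the middle interval first enter [lstar, L) and
land correctly one step later.  So an orbit of the exchange is an orbit of the
rotation by z = alpha / L with its visits to [lstar, L) deleted, and these
visits are the images of the visits to the middle interval.  Hence counting
orbit points of the exchange in [0, t), t <= lstar, and counting rotation
points in [0, s), s <= L, are equivalent up to a bounded factor
([visit_count_discrepancy] and [rotation_discrepancy]), and it remains to see
that the points k z mod 1 have N times discrepancy O(log N) exactly when z is
irrational with bounded averages of partial quotients.

All counts are expressed by fractional parts: for 0 <= t <= 1 the indicator of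
fract x < t is t + fract (x - t) - fract x, so the discrepancy of N points on
an interval is a difference of two sums [fract_sum].  These are governed by
the identity [sum_fract_rational] for rational rotations.

If the averages are bounded, N points split into at most a_1 + ... + a_j blocks
whose lengths are convergent denominators, each contributing at most 3
([fract_sum_block], [fract_sum_digits]).  Denominators at least double every
second step, so j = O(log N), and the sum of digits is O(j)
([fract_sum_discrepancy]).

Conversely, averaging the discrepancy over the length of the interval bounds
the deviation of the sum of fract (k z), k < N, from N / 2 ([fract_sum_mean]).
For rational z this deviation is linear in N ([discrepancy_irrational]).  For
irrational z choose N by taking, at every second level of the Ostrowski
expansion, about half of the allowed number of blocks: all these blocks push
the sum to the same side, and the deviation is at least a constant times the
sum of the corresponding digits, up to O(number of levels)
([fract_sum_bias]).  The two parities give opposite sides, that is, z and - z.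
Such N is at most a convergent denominator, whose logarithm is at most the sum
of log (1 + a_j); since log (1 + a) <= e a + c_e with e as small as desired,
that bound is absorbed and the sum of m digits is O(m)
([digit_average_bounded]). *)

(** * Fractional parts and rational rotations *)

Definition fract {R : realType} (x : R) : R := x - (Num.floor x)%:~R.

Lemma fract_ge0 {R : realType} (x : R) : 0 <= fract x.
Proof. by rewrite subr_ge0 floor_le. Qed.

Lemma fract_lt1 {R : realType} (x : R) : fract x < 1.
Proof. by have := floorD1_gt x; rewrite intrD /fract; lra. Qed.

Lemma fract_unique {R : realType} (x y : R) (n : int) :
  0 <= y < 1 -> x = y + n%:~R -> fract x = y.
Proof.
move=> /andP[y0 y1] xE; rewrite /fract (@floor_def _ x n).
  by rewrite xE addrK.
by rewrite intrD xE; apply/andP; split; lra.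
Qed.

Lemma fractE {R : realType} (x : R) : x = fract x + (Num.floor x)%:~R.
Proof. by rewrite subrK. Qed.

Lemma fractDint {R : realType} (x : R) (n : int) : fract (x + n%:~R) = fract x.
Proof.
apply: (@fract_unique _ _ _ (Num.floor x + n)).
  by rewrite fract_ge0 fract_lt1.
by rewrite intrD addrA -fractE.
Qed.

Lemma fractN {R : realType} (x : R) : fract x != 0 -> fract (- x) = 1 - fract x.
Proof.
move=> x0; apply: (@fract_unique _ _ _ (- Num.floor x - 1)).
  have := fract_ge0 x; have := fract_lt1 x.
  rewrite le_eqVlt eq_sym (negPf x0) /= => ? ?.
  by apply/andP; split; lra.
by rewrite {1}(fractE x) intrB intrN; lra.
Qed.

Lemma le_fract {R : realType} (x y : R) : x <= y -> fract y <= fract x + (y - x).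
Proof.
move=> xy; have : (Num.floor x)%:~R <= (Num.floor y)%:~R :> R.
  by rewrite ler_int le_floor.
by rewrite /fract; lra.
Qed.

(** This turns every counting function of a rotation into a difference of two
sums of fractional parts. *)
Lemma ltr_fract {R : realType} (x t : R) : 0 <= t <= 1 ->
  (fract x < t)%R%:R = t + fract (x - t) - fract x.
Proof.
move=> /andP[t0 t1]; have x0 := fract_ge0 x; have x1 := fract_lt1 x.
have [xt|tx] := ltrP (fract x) t; rewrite ?mulr1n ?mulr0n.
  rewrite (@fract_unique _ (x - t) (fract x - t + 1) (Num.floor x - 1)).
  - by lra.
  - by apply/andP; split; lra.
  - by rewrite {1}(fractE x) intrB; lra.
rewrite (@fract_unique _ (x - t) (fract x - t) (Num.floor x)).
- by lra.
- by apply/andP; split; lra.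
- by rewrite {1}(fractE x); lra.
Qed.

Lemma fract_ratio {R : realType} (r : R) (m : int) (q : nat) :
  (0 < q)%N -> 0 <= r < 1 ->
  fract ((r + m%:~R) / q%:R) = (r + (`|(m %% q)%Z|%N)%:R) / q%:R.
Proof.
move=> q0 /andP[r0 r1]; have qR : 0 < q%:R :> R by rewrite ltr0n.
have mod0 : (0 <= m %% q)%Z by rewrite modz_ge0 //; lia.
have modq : (m %% q < q)%Z by rewrite ltz_pmod //; lia.
have modE : (`|(m %% q)%Z|%N)%:R = (m %% q)%Z%:~R :> R.
  by rewrite -{2}(gez0_abs mod0) -pmulrn.
apply: (@fract_unique _ _ _ (m %/ q)%Z).
  apply/andP; split; first by rewrite divr_ge0 // addr_ge0.
  rewrite ltr_pdivrMr // mul1r modE.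
  have : (m %% q)%Z%:~R + 1 <= q%:R :> R.
    by rewrite (_ : q%:R = q%:Z%:~R) // -(intrD _ _ 1) ler_int; lia.
  by lra.
rewrite modE {1}(divz_eq m q) intrD intrM -pmulrn.
by field; rewrite gt_eqF.
Qed.

Lemma sum_ord_natr {R : realType} (n : nat) :
  \sum_(k < n) k%:R = n%:R * (n%:R - 1) / 2 :> R.
Proof.
elim: n => [|n IHn]; first by rewrite big_ord0 !mul0r.
by rewrite big_ord_recr /= IHn -natr1; field.
Qed.

(** Modulo 1 the q points form a full coset of (1/q)Z, so only the position of
the coset matters: they are (r + i) / q for i < q, with r = fract (q x). *)
Lemma sum_fract_rational {R : realType} (p : int) (q : nat) (x : R) :
  (0 < q)%N -> coprimez p q ->
  \sum_(k < q) fract (x + k%:R * (p%:~R / q%:R)) =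
  fract (q%:R * x) + (q%:R - 1) / 2.
Proof.
move=> q0 pq; have qR : 0 < q%:R :> R by rewrite ltr0n.
have qN0 : q%:R != 0 :> R by rewrite gt_eqF.
set r := fract (q%:R * x); set n := Num.floor (q%:R * x).
have rP : 0 <= r < 1 by rewrite fract_ge0 fract_lt1.
(* Write q x = r + n; the k-th point is r plus the residue of n + p k, all
divided by q, and h is the permutation k |-> n + p k of the residues. *)
have hP (k : 'I_q) : (`|((n + p * k) %% q)%Z| < q)%N.
  have := @ltz_pmod (n + p * k) q.
  have := @modz_ge0 (n + p * k) q.
  by lia.
pose h k := Ordinal (hP k).
have h_inj : injective h.
  move=> i j /(congr1 val) /= hij.
  have {hij} : ((n + p * i) = (n + p * j) %[mod q])%Z.
    have := @modz_ge0 (n + p * i) q; have := @modz_ge0 (n + p * j) q.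
    by lia.
  move/eqP; rewrite eqz_mod_dvd (_ : _ - _ = p * (i%:Z - j%:Z)); last by ring.
  rewrite mulrC Gauss_dvdzl; last by rewrite coprimez_sym.
  move=> /dvdzP[c cE]; apply/val_inj => /=.
  have := ltn_ord i; have := ltn_ord j => jq iq.
  have : (`|c| * q < q)%N.
    by have := congr1 absz cE; rewrite abszM /= => <-; lia.
  rewrite -{2}(mul1n q) ltn_mul2r q0 /= ltnS leqn0 absz_eq0 => /eqP c0.
  by move: cE; rewrite c0 mul0r; lia.
transitivity (\sum_(k < q) (r + (h k)%:R) / q%:R).
  apply: eq_bigr => k _; rewrite -(fract_ratio _ _ _ q0 rP) intrD intrM.
  congr fract; rewrite -pmulrn addrA.
  rewrite /r /n -fractE.
  by field.
rewrite -(reindex_inj h_inj (P := predT) (F := fun i : 'I_q => (r + i%:R) / q%:R)).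
rewrite -mulr_suml big_split /= sumr_const card_ord sum_ord_natr -mulr_natl.
by field.
Qed.

(** * Blocks of consecutive rotation points *)

Definition fract_sum {R : realType} (z : R) (N : nat) (x : R) : R :=
  \sum_(k < N) fract (x + k%:R * z).

Lemma fract_sumD {R : realType} (z x : R) (M N : nat) :
  fract_sum z (M + N) x = fract_sum z M x + fract_sum z N (x + M%:R * z).
Proof.
rewrite /fract_sum big_split_ord /=; congr (_ + _).
by apply: eq_bigr => k _; rewrite natrD mulrDl addrA.
Qed.

Lemma fract_sum_rational {R : realType} (p : int) (q b : nat) :
  (0 < q)%N -> coprimez p q ->
  fract_sum (p%:~R / q%:R) (b * q) 0 = b%:R * (q%:R - 1) / 2 :> R.
Proof.
move=> q0 pq; have qN0 : q%:R != 0 :> R by rewrite pnatr_eq0 -lt0n.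
elim: b => [|b IHb]; first by rewrite /fract_sum big_ord0 !mul0r.
rewrite mulSnr fract_sumD IHb /fract_sum sum_fract_rational //.
rewrite add0r natrM (_ : q%:R * _ = 0 + (p * b * q)%:~R); last first.
  by rewrite !intrM -!pmulrn; field.
rewrite fractDint (@fract_unique _ 0 0 0) ?lexx ?ltr01 ?addr0 //.
by rewrite -natr1; field.
Qed.

(** Replacing z by p / q moves each of the q points by at most 1 / q.  So the sum
is squeezed between the two exact sums over the cosets shifted by - 1 / q and
by 1 / q, whose values depend on the starting point only through
fract (q x). *)
Lemma fract_sum_block {R : realType} (z : R) (p : int) (q : nat) (x y : R) :
  (0 < q)%N -> coprimez p q -> `|q%:R * z - p%:~R| <= q%:R^-1 ->
  `|fract_sum z q y - fract_sum z q x| <= 3.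
Proof.
move=> q0 pq zpq; have qR : 0 < q%:R :> R by rewrite ltr0n.
have qN0 : q%:R != 0 :> R by rewrite gt_eqF.
(* The total displacement of the points; it does not depend on the start, so
it cancels in the difference. *)
pose tau : R := \sum_(k < q) k%:R * (z - p%:~R / q%:R).
have grid k : (k < q)%N -> `|k%:R * (z - p%:~R / q%:R)| <= q%:R^-1.
  move=> kq; rewrite (_ : z - _ = (q%:R * z - p%:~R) / q%:R); last by field.
  rewrite mulrA mulrAC normrM mulrC -[leRHS]mulr1 ler_pM //.
  rewrite ger0_norm ?divr_ge0 // ler_pdivrMr // mul1r ler_nat; lia.
have shift (u e : R) : e = 1 \/ e = -1 ->
    \sum_(k < q) fract (u + e / q%:R + k%:R * (p%:~R / q%:R)) =
    fract (q%:R * u) + (q%:R - 1) / 2.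
  move=> eE; rewrite sum_fract_rational // mulrDr (mulrC q%:R (e / _)) divfK //.
  by case: eE => ->; rewrite (fractDint _ 1, fractDint _ (- 1)).
have sum1 : \sum_(k < q) q%:R^-1 = 1 :> R.
  by rewrite sumr_const card_ord -[_ *+ _]mulr_natl mulfV.
have bounds : forall u : R, fract (q%:R * u) + (q%:R - 1) / 2 + tau - 1 <= fract_sum z q u
    <= fract (q%:R * u) + (q%:R - 1) / 2 + tau + 1.
  move=> v.
  apply/andP; split.
    rewrite -(shift v 1); last by left.
    rewrite -[X in _ - X]sum1 /tau -big_split -sumrB /=; apply: ler_sum => k _.
    have := @le_fract _ (v + k%:R * z) (v + 1 / q%:R + k%:R * (p%:~R / q%:R)).
    have := grid k (ltn_ord k); rewrite ler_norml mulrBr => /andP[? ?].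
    by rewrite div1r => le1; have := le1 ltac:(lra); lra.
  rewrite -(shift v (- 1)); last by right.
  rewrite -[X in _ + X]sum1 /tau -!big_split /=; apply: ler_sum => k _.
  have := @le_fract _ (v + (- 1) / q%:R + k%:R * (p%:~R / q%:R)) (v + k%:R * z).
  have := grid k (ltn_ord k); rewrite ler_norml mulrBr => /andP[? ?].
  by rewrite mulN1r => le1; have := le1 ltac:(lra); lra.
have /andP[? ?] := bounds x; have /andP[? ?] := bounds y.
have := fract_ge0 (q%:R * x); have := fract_lt1 (q%:R * x).
have := fract_ge0 (q%:R * y); have := fract_lt1 (q%:R * y).
by move=> *; rewrite ler_norml; apply/andP; split; lra.
Qed.

(** If q z lies slightly above p, the b q points starting near 0 stay to the
right of the multiples of 1 / q without reaching the next one, so their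
fractional parts are known exactly.  The points p k / q alone fall short of the
mean 1 / 2 by b / 2 in total; the drift recovers at most b / 4 of that when
b q (q z - p) <= 1 / 2, and the offset of the start recovers
b q fract x. *)
Lemma fract_sum_biased_block {R : realType} (z : R) (p : int) (q b : nat)
    (x : R) :
  (0 < q)%N -> coprimez p q -> 0 < q%:R * z - p%:~R ->
  b%:R * (q%:R * z - p%:~R) + fract x <= q%:R^-1 ->
  b%:R * (q%:R * z - p%:~R) * q%:R <= 2^-1 ->
  fract_sum z (b * q) x - (b * q)%:R / 2 <= b%:R * q%:R * fract x - b%:R / 4.
Proof.
move=> q0 pq; have qR : 0 < q%:R :> R by rewrite ltr0n.
have qN0 : q%:R != 0 :> R by rewrite gt_eqF.
set d := _ - _ => d0 bde bdq.
have x0 := fract_ge0 x.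
(* No wrap-around: fract (p k / q) <= 1 - 1 / q and the rest is below 1 / q. *)
have term k : (k < b * q)%N -> fract (x + k%:R * z) =
    fract (0 + k%:R * (p%:~R / q%:R)) + (k%:R * (d / q%:R) + fract x).
  move=> kbq; pose m : int := k%:Z * p.
  have kE : 0 + k%:R * (p%:~R / q%:R) = (0 + m%:~R) / q%:R :> R.
    by rewrite /m intrM -pmulrn !add0r mulrA.
  apply: (@fract_unique _ _ _
    (Num.floor (0 + k%:R * (p%:~R / q%:R) : R) + Num.floor x)).
    apply/andP; split.
      have : 0 <= k%:R * (d / q%:R) by rewrite mulr_ge0 // divr_ge0 // ltW.
      by have := fract_ge0 (0 + k%:R * (p%:~R / q%:R) : R); lra.
    rewrite kE fract_ratio ?lexx ?ltr01 // add0r.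
    have kd : k%:R * (d / q%:R) < b%:R * d.
      rewrite mulrA ltr_pdivrMr // mulrAC ltr_pM2r // -natrM ltr_nat //.
    have : (`|(m %% q)%Z|%N)%:R / q%:R <= 1 - q%:R^-1 :> R.
      rewrite ler_pdivrMr // mulrBl mulVf // mul1r lerBrDr natr1 ler_nat.
      have := @modz_ge0 m q; have := @ltz_pmod m q; lia.
    by lra.
  rewrite intrD [X in X + k%:R * z](fractE x).
  rewrite (_ : k%:R * z = k%:R * (p%:~R / q%:R) + k%:R * (d / q%:R)); last first.
    by rewrite /d; field.
  have := fractE (0 + k%:R * (p%:~R / q%:R) : R); lra.
have -> : fract_sum z (b * q) x =
    b%:R * (q%:R - 1) / 2 + ((b * q)%:R * ((b * q)%:R - 1) / 2 * (d / q%:R)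
    + (b * q)%:R * fract x).
  rewrite -(@fract_sum_rational R p q b q0 pq) -sum_ord_natr mulr_suml.
  rewrite [X in _ + (_ + X)]mulr_natl -[in X in _ + (_ + X)](card_ord (b * q)).
  rewrite -sumr_const -big_split -big_split /=.
  by apply: eq_bigr => k _; exact: term.
have bR : 0 <= b%:R :> R by rewrite ler0n.
have : b%:R * (b%:R * d * q%:R) <= b%:R * 2^-1 by rewrite ler_wpM2l.
have : 0 <= b%:R * d by rewrite mulr_ge0 // ltW.
rewrite natrM (_ : b%:R * q%:R * (b%:R * q%:R - 1) / 2 * (d / q%:R) =
  (b%:R * (b%:R * d * q%:R) - b%:R * d) / 2); last by field.
lra.
Qed.

(** * Continued fractions *)

(** Partial quotients as natural numbers, to serve as numbers of blocks; they
agree with [partial_quotient] from index 1 on when z is irrational. *)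
Definition cf_digit {R : realType} (z : R) (j : nat) : nat :=
  `|partial_quotient z j|%N.

(** Index 0 is the conventional convergent 1 / 0, so [cf_denom z j.+1] is the
classical q_j; this keeps the recursions free of special cases. *)
Fixpoint cf_denom {R : realType} (z : R) (j : nat) : nat :=
  match j with
  | 0 => 0
  | 1 => 1
  | (i.+1 as k).+1 => cf_digit z k * cf_denom z k + cf_denom z i
  end.

Fixpoint cf_num {R : realType} (z : R) (j : nat) : int :=
  match j with
  | 0 => 1
  | 1 => partial_quotient z 0
  | (i.+1 as k).+1 => (cf_digit z k)%:Z * cf_num z k + cf_num z i
  end.

(** The distance |q_(j-1) z - p_(j-1)|, see [cf_approx]. *)
Definition cf_gap {R : realType} (z : R) (j : nat) : R :=
  \prod_(i < j) fract (complete_quotient z i).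

Lemma cf_denomSS {R : realType} (z : R) (j : nat) :
  cf_denom z j.+2 = (cf_digit z j.+1 * cf_denom z j.+1 + cf_denom z j)%N.
Proof. by []. Qed.

Lemma cf_numSS {R : realType} (z : R) (j : nat) :
  cf_num z j.+2 = (cf_digit z j.+1)%:Z * cf_num z j.+1 + cf_num z j.
Proof. by []. Qed.

Lemma cf_gapS {R : realType} (z : R) (j : nat) :
  cf_gap z j.+1 = cf_gap z j * fract (complete_quotient z j).
Proof. by rewrite /cf_gap big_ord_recr. Qed.

Lemma irrational_fract_gt0 {R : realType} (x : R) :
  irrational x -> 0 < fract x.
Proof.
move=> xirr; rewrite lt0r fract_ge0 andbT; apply/eqP => x0; apply: xirr.
by exists (Num.floor x)%:~R => //; rewrite ratr_int [RHS]fractE x0 add0r.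
Qed.

Lemma complete_quotient_irrational {R : realType} (z : R) (j : nat) :
  irrational z -> irrational (complete_quotient z j).
Proof.
move=> zirr; elim: j => //= j IHj [r _ rE]; apply: IHj.
exists (r^-1 + (Num.floor (complete_quotient z j))%:~R) => //.
by rewrite rmorphD fmorphV /= rE invrK ratr_int subrK.
Qed.

Lemma cf_digitE {R : realType} (z : R) (j : nat) : irrational z ->
  (cf_digit z j.+1)%:Z = partial_quotient z j.+1.
Proof.
move=> zirr; rewrite /cf_digit gez0_abs // floor_ge0 invr_ge0.
exact: fract_ge0.
Qed.

Lemma cf_digit_gt0 {R : realType} (z : R) (j : nat) : irrational z ->
  (0 < cf_digit z j.+1)%N.
Proof.
move=> zirr; rewrite /cf_digit absz_gt0 gt_eqF // floor_gt0 /= invf_ge1.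
  by rewrite ltW // fract_lt1.
exact/irrational_fract_gt0/complete_quotient_irrational.
Qed.

Lemma cf_gapSS {R : realType} (z : R) (j : nat) : irrational z ->
  cf_gap z j.+2 = cf_gap z j - (cf_digit z j.+1)%:R * cf_gap z j.+1.
Proof.
move=> zirr; rewrite !cf_gapS.
have := irrational_fract_gt0 _ (complete_quotient_irrational _ j zirr).
have -> : fract (complete_quotient z j.+1) =
    (fract (complete_quotient z j))^-1 - (cf_digit z j.+1)%:R.
  by rewrite [(_)%:R]pmulrn cf_digitE.
by move=> x0; field; rewrite gt_eqF.
Qed.

Lemma cf_gap_gt0 {R : realType} (z : R) (j : nat) : irrational z ->
  0 < cf_gap z j.
Proof.
move=> zirr; apply: prodr_gt0 => i _.
exact/irrational_fract_gt0/complete_quotient_irrational.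
Qed.

Lemma cf_gap_le {R : realType} (z : R) (j : nat) : irrational z ->
  cf_gap z j.+1 <= cf_gap z j.
Proof.
move=> zirr; rewrite cf_gapS ler_piMr //; first exact/ltW/cf_gap_gt0.
by rewrite ltW // fract_lt1.
Qed.

Lemma cf_approx {R : realType} (z : R) (j : nat) : irrational z ->
  (cf_denom z j)%:R * z - (cf_num z j)%:~R = (-1) ^+ j.+1 * cf_gap z j.
Proof.
move=> zirr; pose approx k :=
  (cf_denom z k)%:R * z - (cf_num z k)%:~R = (-1) ^+ k.+1 * cf_gap z k.
suff : approx j /\ approx j.+1 by case.
elim: j => [|j [IH0 IH1]].
  rewrite /approx /cf_gap big_ord_recl !big_ord0 /= /fract /partial_quotient /=.
  by split; ring.
split=> //; rewrite /approx cf_denomSS cf_numSS cf_gapSS // natrD natrM intrD intrM.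
rewrite -pmulrn.
transitivity ((cf_digit z j.+1)%:R * ((cf_denom z j.+1)%:R * z - (cf_num z j.+1)%:~R)
  + ((cf_denom z j)%:R * z - (cf_num z j)%:~R)); first by ring.
by rewrite IH0 IH1 !exprS; ring.
Qed.

(** The determinant identity for convergents, in terms of gaps. *)
Lemma cf_gap_denom {R : realType} (z : R) (j : nat) : irrational z ->
  (cf_denom z j.+1)%:R * cf_gap z j + (cf_denom z j)%:R * cf_gap z j.+1 = 1.
Proof.
move=> zirr; elim: j => [|j IHj].
  by rewrite /cf_gap !big_ord0 /=; ring.
by rewrite cf_denomSS cf_gapSS // -[RHS]IHj natrD natrM; ring.
Qed.

Lemma cf_gap_denom_le1 {R : realType} (z : R) (j : nat) : irrational z ->
  (cf_denom z j.+1)%:R * cf_gap z j <= 1.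
Proof.
move=> zirr; rewrite -[leRHS](cf_gap_denom z j zirr) lerDl mulr_ge0 //.
exact/ltW/cf_gap_gt0.
Qed.

(** The determinant of two successive convergents is a sign. *)
Lemma cf_coprime {R : realType} (z : R) (j : nat) :
  coprimez (cf_num z j) (cf_denom z j).
Proof.
have det : (cf_denom z j.+1)%:Z * cf_num z j - (cf_denom z j)%:Z * cf_num z j.+1
    = (-1) ^+ j.
  elim: j => [|j IHj]; first by rewrite /= mul1r mul0r subr0.
  by rewrite exprS -IHj cf_denomSS cf_numSS PoszD PoszM; ring.
apply/coprimezP.
(* Bezout coefficients: the determinant multiplied by its own sign. *)
exists ((-1) ^+ j * (cf_denom z j.+1)%:Z, - ((-1) ^+ j * cf_num z j.+1)) => /=.
transitivity ((-1) ^+ j * ((-1) ^+ j : int)); last first.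
  by rewrite -expr2 sqrr_sign.
by rewrite -[in X in _ = _ * X]det; ring.
Qed.

Lemma cf_denom_le {R : realType} (z : R) (j : nat) : irrational z ->
  (cf_denom z j <= cf_denom z j.+1)%N.
Proof.
case: j => // j zirr; rewrite cf_denomSS.
by have := cf_digit_gt0 z j zirr; nia.
Qed.

Lemma cf_denom_gt0 {R : realType} (z : R) (j : nat) : irrational z ->
  (0 < cf_denom z j.+1)%N.
Proof.
by move=> zirr; elim: j => // j IHj; apply: leq_trans IHj _; exact: cf_denom_le.
Qed.

(** Growth from below converts a number N of points into O(log N) levels. *)
Lemma cf_denom_exp {R : realType} (z : R) (i : nat) : irrational z ->
  (2 ^ i <= cf_denom z i.*2.+1)%N.
Proof.
move=> zirr; elim: i => // i IHi; rewrite doubleS cf_denomSS expnS.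
have := cf_digit_gt0 z i.*2.+1 zirr.
by have := cf_denom_le z i.*2.+1 zirr; nia.
Qed.

(** Growth from above bounds log of a denominator by the digits. *)
Lemma cf_denom_prod {R : realType} (z : R) (n : nat) : irrational z ->
  (cf_denom z n.+1 <= \prod_(j < n) (cf_digit z j.+1).+1)%N.
Proof.
move=> zirr; elim: n => [|n IHn]; first by rewrite big_ord0.
rewrite big_ord_recr cf_denomSS /= mulnS addnC mulnC leq_add ?leq_mul //.
exact: leq_trans (cf_denom_le z n zirr) IHn.
Qed.

(** * Upper bound for the discrepancy of a rotation *)

(** The tangent of ln at 1 / e; with small e, logarithms are absorbed into
linear terms. *)
Lemma ln_le_linear {R : realType} (e x : R) : 0 < e -> 0 < x ->
  ln x <= e * x - 1 - ln e.
Proof.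
move=> e0 x0; have ex0 : 0 < e * x by rewrite mulr_gt0.
have := @le_ln1Dx R (e * x - 1) ltac:(lra).
by rewrite (addrC 1) subrK lnM ?posrE //; lra.
Qed.

Lemma fract_sum_blocks {R : realType} (z : R) (p : int) (q b : nat) (x y : R) :
  (0 < q)%N -> coprimez p q -> `|q%:R * z - p%:~R| <= q%:R^-1 ->
  `|fract_sum z (b * q) y - fract_sum z (b * q) x| <= 3 * b%:R.
Proof.
move=> q0 pq zpq; elim: b x y => [|b IHb] x y.
  by rewrite /fract_sum !big_ord0 subrr normr0 mulr0.
rewrite mulSn !fract_sumD opprD addrACA -[b.+1%:R]natr1 mulrDr mulr1 addrC.
apply: le_trans (ler_normD _ _) _; apply: lerD; first exact: IHb.
exact: fract_sum_block zpq.
Qed.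

Lemma cf_approx_le {R : realType} (z : R) (j : nat) : irrational z ->
  `|(cf_denom z j.+1)%:R * z - (cf_num z j.+1)%:~R|
    <= (cf_denom z j.+1)%:R^-1.
Proof.
move=> zirr; rewrite cf_approx // normrM normr_sign mul1r.
rewrite gtr0_norm ?cf_gap_gt0 //.
rewrite -[leRHS]mul1r ler_pdivlMr ?ltr0n ?cf_denom_gt0 // mulrC.
apply: le_trans (cf_gap_denom_le1 z j zirr).
by rewrite ler_wpM2l ?ler0n // cf_gap_le.
Qed.

(** The Ostrowski expansion, taken greedily: at each level Euclidean division
splits off at most a_(j+1) blocks whose length is the convergent
denominator. *)
Lemma fract_sum_digits {R : realType} (z : R) (j M : nat) (x y : R) :
  irrational z -> (M < cf_denom z j.+1)%N ->
  `|fract_sum z M y - fract_sum z M x| <=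
    3 * \sum_(i < j) (cf_digit z i.+1)%:R.
Proof.
move=> zirr; elim: j M x y => [|j IHj] M x y.
  rewrite ltnS leqn0 => /eqP ->.
  by rewrite /fract_sum !big_ord0 subrr normr0 mulr0.
rewrite cf_denomSS => MQ; have Q0 := cf_denom_gt0 z j zirr.
rewrite (divn_eq M (cf_denom z j.+1)) !fract_sumD opprD addrACA.
rewrite big_ord_recr /= mulrDr addrC.
apply: le_trans (ler_normD _ _) _; apply: lerD.
  by apply: IHj; rewrite ltn_mod.
apply: le_trans (fract_sum_blocks _ _ _ _ _ _ Q0 (cf_coprime _ _) _) _.
  exact: cf_approx_le.
rewrite ler_pM2l // ler_nat -ltnS ltn_divLR //.
apply: leq_trans MQ _; rewrite mulSn addnC leq_add2r.
exact: cf_denom_le.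
Qed.

Lemma fract_sum_discrepancy {R : realType} (z K : R) : irrational z ->
  (forall m, \sum_(j < m) (cf_digit z j.+1)%:R <= K * m%:R) ->
  exists C, forall N x y, (0 < N)%N ->
    `|fract_sum z N y - fract_sum z N x| <= C * (1 + ln N%:R).
Proof.
move=> zirr HK; have ln2 : 0 < ln 2 :> R by rewrite ln_gt0 // ltr1n.
have K0 : 0 <= K.
  by have := HK 1%N; rewrite mulr1; apply: le_trans; rewrite sumr_ge0.
exists (6 * K * (1 + (ln 2)^-1)) => N x y N0.
(* 2 ^ i <= N < 2 ^ (i + 1), so 2 (i + 1) levels suffice. *)
pose i := trunc_log 2 N.
have iN : i%:R <= ln N%:R / ln 2 :> R.
  rewrite ler_pdivlMr // mulr_natl -lnXn //.
  rewrite ler_ln ?posrE ?exprn_gt0 ?ltr0n // -natrX ler_nat.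
  by rewrite trunc_logP.
have NQ : (N < cf_denom z (i.+1).*2.+1)%N.
  by apply: leq_trans (cf_denom_exp z i.+1 zirr); rewrite trunc_log_ltn.
apply: le_trans (fract_sum_digits z _ N x y zirr NQ) _.
have := HK (i.+1).*2; set S := \sum_(_ < _) _ => SK.
have lnN : 0 <= ln N%:R :> R by rewrite ln_ge0 // ler1n.
apply: (@le_trans _ _ (6 * K * i.+1%:R)).
  by move: SK; rewrite -muln2 natrM; lra.
rewrite -[leRHS]mulrA ler_wpM2l ?mulr_ge0 // -[i.+1%:R]natr1.
have : 0 <= (ln 2)^-1 :> R by rewrite invr_ge0 ltW.
by lra.
Qed.

(** * Lower bound for the discrepancy of a rotation *)

Lemma coprimez_sign (p q : int) (e : nat) :
  coprimez ((-1) ^+ e * p) q = coprimez p q.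
Proof.
by rewrite -signr_odd; case: (odd e); rewrite ?mulN1r ?mul1r ?coprimeNz.
Qed.

(** Every second level is used, starting at level e; the sign (-1) ^ e makes all
the gaps used point to the right.  The lowest level comes last, so that the
blocks of the higher levels only contribute a small positive offset, and
each level takes half of its digit, which keeps the position of the endpoint
below half of the current gap.  The induction is on the number of levels,
removing the lowest one. *)
Lemma fract_sum_bias {R : realType} (z : R) (n e : nat) : irrational z ->
  exists M : nat,
  [/\ (M + cf_denom z e <= cf_denom z (e + n.*2))%N,
      fract (M%:R * ((-1) ^+ e * z)) <= cf_gap z e / 2 &
      fract_sum ((-1) ^+ e * z) M 0 - M%:R / 2 <=
        (3 * n%:R - \sum_(i < n) (cf_digit z (e + i.*2.+1))%:R) / 8].
Proof.
move=> zirr; elim: n e => [|n IHn] e.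
  exists 0%N; split; first by rewrite add0n addn0.
    rewrite mul0r (@fract_unique _ _ 0 0) ?lexx ?ltr01 ?addr0 //.
    by have := cf_gap_gt0 z e zirr; lra.
  by rewrite /fract_sum !big_ord0; lra.
have [M []] := IHn e.+2; rewrite !exprS !mulN1r opprK.
set th := _ ^+ e * z => MQ Mgap Msum.
set a := cf_digit z e.+1; pose b := a./2.
have aE : a = (odd a + b.*2)%N by rewrite odd_double_half.
have ba : (b.*2 <= a)%N by rewrite aE leq_addl.
have bR : b%:R <= a%:R / 2 :> R.
  by rewrite ler_pdivlMr // -natrM ler_nat aE; lia.
have aR : a%:R <= 2 * b%:R + 1 :> R.
  rewrite {1}aE natrD -muln2 natrM mulrC addrC lerD2l.
  by case: (odd a).
have q0 := cf_denom_gt0 z e zirr.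
have g0 := cf_gap_gt0 z e zirr; have g1 := cf_gap_gt0 z e.+1 zirr.
have g2 := cf_gap_gt0 z e.+2 zirr.
have gE : (cf_denom z e.+1)%:R * th - ((-1) ^+ e * cf_num z e.+1)%:~R
    = cf_gap z e.+1.
  rewrite /th intrM (rmorphXn _ e) mulrCA -mulrBr cf_approx // mulrA.
  by rewrite !exprS !mulN1r opprK -expr2 sqrr_sign mul1r.
have ag : a%:R * cf_gap z e.+1 = cf_gap z e - cf_gap z e.+2.
  by rewrite (cf_gapSS z e zirr) opprB addrC subrK.
have bg : b%:R * cf_gap z e.+1 <= (cf_gap z e - cf_gap z e.+2) / 2.
  by rewrite -ag mulrAC ler_pM2r.
have gq : cf_gap z e <= (cf_denom z e.+1)%:R^-1.
  rewrite -[leRHS]mul1r ler_pdivlMr ?ltr0n // mulrC.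
  exact: cf_gap_denom_le1.
have q1 : (cf_denom z e.+1)%:R^-1 <= 1 :> R.
  by rewrite invf_le1 ?ltr0n // ler1n.
have f0 := fract_ge0 (M%:R * th).
exists (M + b * cf_denom z e.+1)%N; split.
- rewrite !addSn in MQ.
  rewrite doubleS !addnS; apply: leq_trans MQ.
  rewrite -addnA leq_add2l cf_denomSS leq_add2r leq_mul2r -/a.
  by rewrite (leq_trans _ ba) ?orbT // -addnn leq_addr.
- rewrite (@fract_unique _ _ (fract (M%:R * th) + b%:R * cf_gap z e.+1)
    (Num.floor (M%:R * th) + b%:Z * ((-1) ^+ e * cf_num z e.+1))).
  + by lra.
  + apply/andP; split; last by lra.
    by rewrite addr_ge0 // mulr_ge0 // ltW.
  + have := fractE (M%:R * th); rewrite -gE natrD natrM intrD.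
    rewrite [(b%:Z * _)%:~R]intrM -pmulrn.
    by move: (Num.floor _)%:~R (fract _) => u v; rewrite mulrDl => ->; ring.
rewrite fract_sumD add0r natrD.
have := @fract_sum_biased_block _ th ((-1) ^+ e * cf_num z e.+1)
  (cf_denom z e.+1) b (M%:R * th) q0.
rewrite coprimez_sign cf_coprime gE => /(_ isT g1) blk.
have {blk} := blk ltac:(lra).
have -> : b%:R * cf_gap z e.+1 * (cf_denom z e.+1)%:R <= 2^-1 :> R.
  have := cf_gap_denom_le1 z e zirr; rewrite mulrC => gq1.
  apply: le_trans (_ : cf_gap z e / 2 * (cf_denom z e.+1)%:R <= _).
    by rewrite ler_pM2r ?ltr0n //; lra.
  by rewrite mulrAC; lra.
move=> /(_ isT) blk.
(* The offset left by the higher levels costs O(1) at each level. *)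
have err : b%:R * (cf_denom z e.+1)%:R * fract (M%:R * th) <= 4^-1.
  apply: le_trans (_ : (cf_denom z e.+2)%:R / 2 * (cf_gap z e.+2 / 2) <= _).
    apply: ler_pM => //; rewrite ?mulr_ge0 //.
    rewrite ler_pdivlMr // -!natrM ler_nat cf_denomSS -/a.
    by rewrite mulnAC muln2 (leq_trans _ (leq_addr _ _)) // leq_mul2r ba orbT.
  have := cf_gap_denom_le1 z e.+1 zirr.
  have : (cf_denom z e.+2)%:R * cf_gap z e.+2 <=
      (cf_denom z e.+2)%:R * cf_gap z e.+1.
    by rewrite ler_wpM2l ?ler0n // cf_gap_le.
  lra.
rewrite big_ord_recl /= addn1 -/a.
under eq_bigr => i _ do rewrite /bump add1n doubleS addnS addnS -addSn -addSn.
rewrite -[n.+1%:R]natr1.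
by lra.
Qed.

Lemma irrational_natmul {R : realType} (z : R) (k : nat) :
  (0 < k)%N -> irrational z -> irrational (k%:R * z).
Proof.
move=> k0 zirr [r _ rE]; apply: zirr; exists (r / k%:R) => //.
rewrite rmorphM fmorphV /= ratr_nat rE mulrAC divff ?mul1r //.
by rewrite pnatr_eq0 -lt0n.
Qed.

(** fract (- x) = 1 - fract x unless x is an integer, which happens only for the
term k = 0. *)
Lemma fract_sumN {R : realType} (z : R) (M : nat) : irrational z ->
  M%:R - 1 <= fract_sum (- z) M 0 + fract_sum z M 0.
Proof.
move=> zirr; case: M => [|M]; first by rewrite /fract_sum !big_ord0; lra.
rewrite /fract_sum -big_split big_ord_recl /= -[leLHS]add0r.
apply: lerD; first by rewrite addr_ge0 // fract_ge0.
rewrite -natr1 addrK -[M in leLHS]card_ord -sumr_const ler_sum // => i _.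
rewrite !add0r mulrN fractN ?subrK // gt_eqF //.
exact/irrational_fract_gt0/irrational_natmul.
Qed.

(** [fract_sum_bias] for z and for - z bounds the digits of odd and of even index;
together the sum T of 2 n digits is at most 16 C log q + O(n), with q the
denominator of level 2 n, while log q <= e T + O(n).  For small e this bounds
T linearly. *)
Lemma digit_average_bounded {R : realType} (z C : R) : irrational z ->
  (forall N, (0 < N)%N ->
    `|fract_sum z N 0 - N%:R / 2| <= C * (1 + ln N%:R)) ->
  exists K : R, forall m, \sum_(j < m) (cf_digit z j.+1)%:R <= K * m%:R.
Proof.
move=> zirr HC.
have C0 : 0 <= C.
  by have := HC 1%N isT; rewrite ln1 addr0 mulr1; apply: le_trans.
(* Small enough that half of the digit sum survives on the left. *)
pose e := (32 * (C + 1))^-1; have e0 : 0 < e by rewrite invr_gt0; lra.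
have Ce : 16 * C * e <= 2^-1.
  by rewrite ler_pdivrMr ?ler_pdivlMl; lra.
pose c := e - 1 - ln e.
pose T n : R := \sum_(j < n) (cf_digit z j.+1)%:R.
have T0 n : 0 <= T n by rewrite sumr_ge0.
have lnQ n : ln (cf_denom z n.+1)%:R <= e * T n + n%:R * c.
  apply: le_trans (_ : ln (\prod_(j < n) (cf_digit z j.+1).+1)%:R <= _).
    rewrite ler_ln ?posrE ?ltr0n ?cf_denom_gt0 ?prodn_gt0 //.
    by rewrite ler_nat cf_denom_prod.
  elim: n => [|n IHn]; first by rewrite /T !big_ord0 ln1 mulr0 mul0r addr0.
  rewrite big_ord_recr natrM lnM ?posrE ?ltr0n ?prodn_gt0 //= /T big_ord_recr /=.
  have := ln_le_linear e (cf_digit z n.+1).+1%:R e0 (ltr0Sn _ _).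
  rewrite -[n.+1%:R]natr1 -[(cf_digit z n.+1).+1%:R]natr1 -/(T n).
  by rewrite /c in IHn *; lra.
have err n M : (M <= cf_denom z n.*2.+1)%N ->
    `|fract_sum z M 0 - M%:R / 2| <= C * (1 + ln (cf_denom z n.*2.+1)%:R).
  case: (posnP M) => [->|M0] MQ.
    rewrite /fract_sum big_ord0 mul0r subrr normr0 mulr_ge0 // addr_ge0 //.
    by rewrite ln_ge0 // ler1n cf_denom_gt0.
  apply: le_trans (HC M M0) _; rewrite ler_wpM2l // lerD2l.
  by rewrite ler_ln ?posrE ?ltr0n ?cf_denom_gt0 // ler_nat.
have split2 n : T n.*2 = \sum_(i < n) (cf_digit z i.*2.+1)%:R +
    \sum_(i < n) (cf_digit z (i.*2.+1).+1)%:R.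
  elim: n => [|n IHn]; first by rewrite /T !big_ord0 addr0.
  by rewrite doubleS /T !big_ord_recr /= -/(T _) IHn; ring.
have main n : T n.*2 <=
    16 * C * (1 + ln (cf_denom z n.*2.+1)%:R) + 8 + 6 * n%:R.
  have [M0 []] := fract_sum_bias z n 0%N zirr.
  rewrite expr0 mul1r add0n => /(leq_trans (leq_addr _ _)) M0Q _ M0S.
  have [M1 []] := fract_sum_bias z n 1%N zirr.
  rewrite expr1 mulN1r add1n => /(leq_trans (leq_addr _ _)) M1Q _ M1S.
  have := err n M0 (leq_trans M0Q (cf_denom_le _ _ zirr)).
  have := err n M1 M1Q; have := fract_sumN z M1 zirr.
  rewrite !ler_norml => S1 /andP[_ E1] /andP[E0 _].
  move: M0S M1S; do 2![under eq_bigr do rewrite ?(add0n, add1n); move=> ?].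
  by rewrite split2; lra.
exists (32 * C + 16 + `|64 * C * c| + 12) => -[|m].
  by rewrite big_ord0 mulr0.
have : T m.+1 <= T (m.+1).*2.
  rewrite /T -addnn big_split_ord /= lerDl sumr_ge0 //.
have := main m.+1; have := lnQ (m.+1).*2; rewrite -muln2 natrM.
move: (ln _) (T (m.+1 * 2)%N) (T0 (m.+1 * 2)%N) => l t t0 lt tl Tt.
have m1 : 1 <= m.+1%:R :> R by rewrite ler1n.
have : 16 * C * l <= 16 * C * (e * t + m.+1%:R * 2 * c).
  by rewrite ler_wpM2l // mulr_ge0.
have : (16 * C * e) * t <= 2^-1 * t by rewrite ler_wpM2r.
have : (64 * C * c) * m.+1%:R <= `|64 * C * c| * m.+1%:R.
  by rewrite ler_wpM2r // ler_norm.
have : (32 * C + 16) * 1 <= (32 * C + 16) * m.+1%:R.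
  by rewrite ler_wpM2l //; lra.
rewrite -/(T m.+1); lra.
Qed.

(** For z = p / q the sum over n q points is n (q - 1) / 2, which misses the mean
n q / 2 by n / 2; this is not O(log n). *)
Lemma discrepancy_irrational {R : realType} (z C : R) :
  (forall N, (0 < N)%N ->
    `|fract_sum z N 0 - N%:R / 2| <= C * (1 + ln N%:R)) ->
  irrational z.
Proof.
move=> HC [r _ rE].
have C0 : 0 <= C.
  by have := HC 1%N isT; rewrite ln1 addr0 mulr1; apply: le_trans.
pose q := `|denq r|%N; have q0 : (0 < q)%N by rewrite absz_gt0 denq_neq0.
have qR : 0 < q%:R :> R by rewrite ltr0n.
have zE : z = (numq r)%:~R / q%:R.
  rewrite -rE -[in LHS](divq_num_den r) rmorphM fmorphV /= !ratr_int.
  by rewrite [q%:R]pmulrn gez0_abs // denq_ge0.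
have pq : coprimez (numq r) q by rewrite /coprimez /gcdz; have := coprime_num_den r.
pose e := (4 * (C + 1) * q%:R)^-1.
have e0 : 0 < e by rewrite invr_gt0 mulr_gt0 //; lra.
have Ceq : C * e * q%:R <= 4^-1.
  rewrite /e invfM -!mulrA mulVf ?gt_eqF // mulr1.
  by rewrite ler_pdivrMr; lra.
(* Any n > 4 C |ln e| contradicts the estimate. *)
pose n := (Num.truncn (4 * C * `|ln e|)).+1.
have nP : 4 * C * `|ln e| < n%:R.
  by rewrite /n; apply: truncnS_gt.
have := HC (n * q)%N; rewrite muln_gt0 q0 => /(_ isT).
rewrite zE fract_sum_rational // natrM.
have := ln_le_linear e (n%:R * q%:R) e0.
rewrite mulr_gt0 ?ltr0n // => /(_ isT) lnq.
have -> : n%:R * (q%:R - 1) / 2 - n%:R * q%:R / 2 = - (n%:R / 2) :> R.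
  by field.
rewrite normrN ger0_norm ?divr_ge0 // => nC.
have : C * (1 + ln (n%:R * q%:R)) <= C * (e * (n%:R * q%:R) - ln e).
  by rewrite ler_wpM2l //; lra.
have : (C * e * q%:R) * n%:R <= 4^-1 * n%:R by rewrite ler_wpM2r.
have : C * - ln e <= C * `|ln e| by rewrite ler_wpM2l // -normrN ler_norm.
lra.
Qed.

(** * The exchange as a first-return map *)

Lemma sum_letter {R : realType} (P : pred letter) (F : letter -> R) :
  \sum_(l | P l) F l =
  (if P LetA then F LetA else 0) + (if P LetB then F LetB else 0) +
  (if P LetC then F LetC else 0).
Proof.
rewrite big_mkcond -big_enum (perm_big [:: LetA; LetB; LetC]) /=.
  by rewrite !big_cons big_nil addr0 addrA.
have memE l : l \in [:: LetA; LetB; LetC].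
  by rewrite -has_pred1 has_count letter_enumP.
apply: uniq_perm => [||l]; rewrite ?enum_uniq ?mem_enum ?memE //.
by apply: count_mem_uniq => l; rewrite memE letter_enumP.
Qed.

Lemma iet3E {R : realType} (lA lB lC x : R) :
  0 < lA -> 0 < lB -> 0 < lC -> 0 <= x < lA + lB + lC ->
  iet (letter_data 1 2 3)%N (letter_data 3 2 1)%N (letter_data lA lB lC) x =
  if x < lA then x + (lB + lC) else
  if x < lA + lB then x + (lC - lA) else x - (lA + lB).
Proof.
move=> hA hB hC /andP[x0 x1]; rewrite /iet.
case: pickP => [a|none].
  rewrite /iet_interval /iet_shift /iet_left !sum_letter.
  by case: a => /=; rewrite in_itv /= => /andP[? ?]; do 2?[case: ltP => ?]; lra.
have := none LetA; have := none LetB; have := none LetC.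
rewrite /iet_interval /iet_left !sum_letter /= !in_itv /=.
move=> /negbT /nandP nC /negbT /nandP nB /negbT /nandP nA.
by case: nA => /negP nA; case: nB => /negP nB; case: nC => /negP nC;
  exfalso; lra.
Qed.

(** The time at which the rotation reaches the N-th point of the orbit u: each
visit to the middle interval costs one additional step. *)
Definition rotation_time {R : realType} (lA lB : R) (u : nat -> R) (N : nat) :
    nat :=
  (\sum_(n < N) (1 + (lA <= u n < lA + lB)%R))%N.

Lemma rotation_timeS {R : realType} (lA lB : R) (u : nat -> R) (N : nat) :
  rotation_time lA lB u N.+1 =
  (rotation_time lA lB u N + (1 + (lA <= u N < lA + lB)%R))%N.
Proof. by rewrite /rotation_time big_ord_recr. Qed.

Lemma rotation_time_bounds {R : realType} (lA lB : R) (u : nat -> R) (N : nat) :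
  (N <= rotation_time lA lB u N <= N.*2)%N.
Proof.
elim: N => [|N IHN]; first by rewrite /rotation_time big_ord0.
by rewrite rotation_timeS; case: (lA <= _ < _); move: IHN; lia.
Qed.

(** Consecutive values of [rotation_time] differ by at most 2. *)
Lemma rotation_time_near {R : realType} (lA lB : R) (u : nat -> R) (M : nat) :
  exists N, M = rotation_time lA lB u N \/ M = (rotation_time lA lB u N).+1.
Proof.
elim: M => [|M [N [MN|MN]]].
- by exists 0%N; left; rewrite /rotation_time big_ord0.
- by exists N; right; rewrite MN.
exists N.+1; rewrite rotation_timeS MN.
by case: (lA <= _ < _) => /=; [left|right]; lia.
Qed.

Section Induced.
Context {R : realType} (lA lB lC : R).
Hypotheses (hA : 0 < lA) (hB : 0 < lB) (hC : 0 < lC).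
Let lstar := lA + lB + lC.
Let L := lstar + lB.
Let alpha := lB + lC.
Let z := alpha / L.
Let f := iet (letter_data 1 2 3)%N (letter_data 3 2 1)%N
             (letter_data lA lB lC).
Context (y : R).
Hypothesis y_in : 0 <= y < lstar.
Let u n := iter n f y.
Let time := rotation_time lA lB u.
Let pt k := L * fract (y / L + k%:R * z).

Let lengths_gt0 : [/\ 0 < lA, 0 < lB & 0 < lC]. Proof. by []. Qed.

Let L_gt0 : 0 < L.
Proof. by rewrite /L /lstar !addr_gt0. Qed.

(** To identify the next rotation point it is enough to find a representative
modulo L in [0, L). *)
Lemma rotation_step (k : nat) (v : R) (m : int) :
  0 <= v < L -> v = pt k + alpha + L * m%:~R -> pt k.+1 = v.
Proof.
move=> /andP[v0 vL] vE; have LN0 : L != 0 by rewrite gt_eqF.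
rewrite /pt (@fract_unique _ _ (v / L)
  (Num.floor (y / L + k%:R * z) - m)); first by rewrite mulrC divfK.
  by rewrite divr_ge0 ?(ltW L_gt0) //= ltr_pdivrMr // mul1r.
move: vE; rewrite /pt; have := fractE (y / L + k%:R * z).
move: (fract _) (Num.floor _) => r n rE ->; rewrite -natr1 mulrDl mul1r addrA rE intrB /z.
by field.
Qed.

Lemma orbit_rotation (n : nat) : 0 <= u n < lstar /\ u n = pt (time n).
Proof.
have [? ? ?] := lengths_gt0.
elim: n => [|n [un IHn]].
  split=> //; rewrite /time /rotation_time big_ord0 /pt mul0r addr0.
  rewrite (@fract_unique _ _ (y / L) 0) ?addr0 //.
    by rewrite mulrC divfK // gt_eqF.
  move: y_in => /andP[y0 y1].
  rewrite divr_ge0 ?(ltW L_gt0) //= ltr_pdivrMr // mul1r.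
  by rewrite /L; lra.
rewrite /time rotation_timeS -/time.
have -> : u n.+1 = f (u n) by [].
rewrite /f iet3E //; case/andP: (un) => u0 u1.
have [uA|uA] := ltP (u n) lA; rewrite ?add0n ?addn1.
  split; first by rewrite /lstar; lra.
  apply/esym/(@rotation_step _ _ 0); last by rewrite -IHn /alpha; lra.
  by rewrite /L /lstar; lra.
have [uB|uB] := ltP (u n) (lA + lB) => /=; rewrite ?addn1 ?addn2.
  split; first by rewrite /lstar in u1 *; lra.
  apply/esym/(@rotation_step _ _ (- 1)).
    by rewrite /L /lstar in u1 *; lra.
  rewrite (@rotation_step _ (u n + alpha) 0); last by rewrite -IHn; lra.
    by rewrite /L /lstar /alpha; lra.
  by rewrite /L /lstar /alpha in u1 *; lra.
split; first by rewrite /lstar in u1 *; lra.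
apply/esym/(@rotation_step _ _ (- 1)).
  by rewrite /L /lstar in u1 *; lra.
by rewrite -IHn /L /lstar /alpha; lra.
Qed.

(** The rotation orbit up to the N-th return consists of the orbit of the exchange
and the images of its visits to the middle interval. *)
Lemma sum_rotation (g : R -> R) (N : nat) :
  \sum_(k < time N) g (pt k) =
  \sum_(n < N) (g (u n) + g (u n + alpha) *+ (lA <= u n < lA + lB)%R).
Proof.
have [? ? ?] := lengths_gt0.
elim: N => [|N IHN]; first by rewrite /time /rotation_time !big_ord0.
rewrite big_ord_recr /= -IHN /time rotation_timeS -/time.
have [/andP[u0 u1] uE] := orbit_rotation N.
have [/andP[uA uB]|uAB] := boolP (lA <= u N < lA + lB).
  rewrite addn2 !big_ord_recr /= -uE mulr1n -addrA; congr (_ + (_ + g _)).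
  apply: (@rotation_step _ _ 0); last by rewrite -uE; lra.
  by rewrite /L /lstar /alpha; lra.
by rewrite addn1 big_ord_recr /= -uE mulr0n addr0.
Qed.

Definition visit_count (N : nat) (t : R) : R := \sum_(n < N) (u n < t)%R%:R.

Lemma rotation_count (M : nat) (t : R) : 0 <= t <= L ->
  \sum_(k < M) (pt k < t)%R%:R =
  M%:R * (t / L) + (fract_sum z M (y / L - t / L) - fract_sum z M (y / L)).
Proof.
move=> /andP[t0 tL].
rewrite mulr_natl -[in X in X + _](card_ord M) -sumr_const /fract_sum.
rewrite -sumrB -big_split /=; apply: eq_bigr => k _.
rewrite /pt mulrC -ltr_pdivlMr // ltr_fract.
  by rewrite -addrA (addrAC (y / L) (k%:R * z)).
by rewrite divr_ge0 ?(ltW L_gt0) //= ler_pdivrMr // mul1r.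
Qed.

Lemma visit_count_low (N : nat) (t : R) : 0 <= t <= lstar ->
  \sum_(k < time N) (pt k < t)%R%:R = visit_count N t.
Proof.
have [? ? ?] := lengths_gt0.
move=> /andP[t0 t1].
rewrite (sum_rotation (fun v => (v < t)%R%:R)); apply: eq_bigr => n _.
case: (boolP (lA <= u n < _)) => [/andP[uA _]|_]; last by rewrite mulr0n addr0.
have -> : (u n + alpha < t) = false.
  by apply/negbTE; rewrite -leNgt; rewrite /lstar in t1; rewrite /alpha; lra.
by rewrite addr0.
Qed.

(** The arc [lstar, t) is the rotated image of [lA, t - alpha), a part of the
middle interval. *)
Lemma visit_count_high (N : nat) (t : R) : lstar <= t <= L ->
  \sum_(k < time N) (pt k < t)%R%:R =
  N%:R + (visit_count N (t - alpha) - visit_count N lA).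
Proof.
have [? ? ?] := lengths_gt0.
move=> /andP[t0 t1].
rewrite (sum_rotation (fun v => (v < t)%R%:R)).
rewrite /visit_count -[N in N%:R]card_ord -sumr_const -sumrB -big_split.
apply: eq_bigr => n _ /=.
have [/andP[u0 u1] _] := orbit_rotation n.
have -> : u n < t by apply: lt_le_trans t0.
rewrite -ltrBrDr; congr (_ + _).
have [uA|uA] := leP lA (u n); rewrite /=.
  have [uB|uB] := ltP (u n) (lA + lB); first by rewrite mulr1n subr0.
  have -> : (u n < t - alpha) = false; last by rewrite subr0.
  apply/negbTE; rewrite -leNgt; move: t1; rewrite /L /lstar /alpha; lra.
have -> : u n < t - alpha; last by rewrite subrr.
by move: t0; rewrite /lstar /alpha; lra.
Qed.

Lemma visit_count_full (N : nat) : visit_count N lstar = N%:R.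
Proof.
rewrite /visit_count -[N in RHS]card_ord -sumr_const.
by apply: eq_bigr => n _; have [/andP[_ ->]] := orbit_rotation n.
Qed.

Lemma visitsE (N : nat) (t : R) :
  (visits u `[0, t[%classic N)%:R = visit_count N t.
Proof.
rewrite /visits -sum1_card natr_sum big_mkcond /=; apply: eq_bigr => n _.
have [/andP[u0 _] _] := orbit_rotation n.
by rewrite !inE /= mem_setE in_itv /= u0 /=; case: (_ < _).
Qed.

(** The number of rotation steps is itself controlled by counting in the whole
interval [0, lstar), and can then be eliminated. *)
Lemma visit_count_discrepancy (C : R) :
  (forall N x x', (0 < N)%N ->
     `|fract_sum z N x' - fract_sum z N x| <= C * (1 + ln N%:R)) ->
  forall N t, (0 < N)%N -> 0 <= t <= lstar ->
    `|visit_count N t - N%:R * (t / lstar)| <= 2 * C * (1 + ln 2 + ln N%:R).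
Proof.
have [? ? ?] := lengths_gt0.
move=> HC N t N0 /andP[t0 t1].
have l0 : 0 < lstar by rewrite /lstar; lra.
have C0 : 0 <= C.
  by have := HC 1%N 0 0 isT; rewrite ln1 addr0 mulr1; apply: le_trans.
have /andP[NT TN] := rotation_time_bounds lA lB u N; rewrite -/time in NT TN.
have T0 : (0 < time N)%N by apply: leq_trans NT.
have {}HC s : 0 <= s <= lstar ->
    `|visit_count N s - (time N)%:R * (s / L)| <= C * (1 + ln 2 + ln N%:R).
  move=> /andP[s0 s1]; rewrite -visit_count_low ?s0 // rotation_count; last first.
    by rewrite s0 /= (le_trans s1) // /L; lra.
  rewrite addrC addKr; apply: le_trans (HC _ _ _ T0) _.
  rewrite ler_wpM2l // -addrA lerD2l -lnM ?posrE ?ltr0n //.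
  by rewrite ler_ln ?posrE ?mulr_gt0 ?ltr0n // -natrM ler_nat mul2n.
have Ht := HC t ltac:(lra).
have := HC lstar ltac:(lra); rewrite visit_count_full => Hl.
have LN0 : L != 0 by rewrite gt_eqF.
have lN0 : lstar != 0 by rewrite gt_eqF.
have -> : visit_count N t - N%:R * (t / lstar) =
    (visit_count N t - (time N)%:R * (t / L)) -
    t / lstar * (N%:R - (time N)%:R * (lstar / L)) by field; rewrite LN0 lN0.
apply: le_trans (ler_normB _ _) _.
have tl : `|t / lstar| <= 1.
  by rewrite ger0_norm ?divr_ge0 ?ler_pdivrMr ?mul1r // ltW.
have : `|t / lstar * (N%:R - (time N)%:R * (lstar / L))| <=
    1 * (C * (1 + ln 2 + ln N%:R)) by rewrite normrM ler_pM.
lra.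
Qed.

(** The counts of the exchange determine those of the rotation in [0, s L) for
all s <= 1, also for arcs that leave [0, lstar); taking s = 1 compares the number
of rotation steps with N.  A time between two returns costs one more point. *)
Lemma rotation_discrepancy (C : R) :
  (forall N t, (0 < N)%N -> 0 <= t <= lstar ->
     `|visit_count N t - N%:R * (t / lstar)| <= C * (1 + ln N%:R)) ->
  forall M s, (0 < M)%N -> 0 <= s <= 1 ->
    `|fract_sum z M (y / L - s) - fract_sum z M (y / L)| <=
    (4 * C + 1) * (1 + ln M%:R).
Proof.
have [? ? ?] := lengths_gt0.
move=> HC M s M0 /andP[s0 s1].
have l0 : 0 < lstar by rewrite /lstar; lra.
have C0 : 0 <= C.
  have := HC 1%N 0 isT; rewrite ln1 addr0 mulr1 lexx (ltW l0) => /(_ isT).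
  exact: le_trans.
have LN0 : L != 0 by rewrite gt_eqF.
have lN0 : lstar != 0 by rewrite gt_eqF.
have count N t : (0 < N)%N -> 0 <= t <= L ->
    `|\sum_(k < time N) (pt k < t)%R%:R - N%:R * (t / lstar)| <=
    2 * (C * (1 + ln N%:R)).
  move=> N0 /andP[t0 tL].
  have E0 : 0 <= C * (1 + ln N%:R).
    by rewrite mulr_ge0 // addr_ge0 // ln_ge0 // ler1n.
  have [tl|tl] := leP t lstar.
    rewrite visit_count_low ?t0 //.
    by apply: le_trans (HC N t N0 _) _; rewrite ?t0 //; lra.
  rewrite visit_count_high ?(ltW tl) //.
  have := HC N lA N0 ltac:(rewrite /lstar; lra).
  have := HC N (t - alpha) N0
    ltac:(move: tl tL; rewrite /L /lstar /alpha; lra).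
  have -> : N%:R + (visit_count N (t - alpha) - visit_count N lA)
      - N%:R * (t / lstar) =
    (visit_count N (t - alpha) - N%:R * ((t - alpha) / lstar)) -
    (visit_count N lA - N%:R * (lA / lstar)).
    rewrite (_ : t - alpha = t - lstar + lA); last by rewrite /alpha /lstar; ring.
    by move: (visit_count N _) => v; field.
  by move=> a b; apply: le_trans (ler_normB _ _) _; move: a b; lra.
have countL N : \sum_(k < time N) (pt k < L)%R%:R = (time N)%:R.
  rewrite -[in RHS](card_ord (time N)) -sumr_const; apply: eq_bigr => k _.
  by rewrite /pt gtr_pMr // fract_lt1.
have times N : (0 < N)%N ->
    `|fract_sum z (time N) (y / L - s) - fract_sum z (time N) (y / L)| <=
    4 * C * (1 + ln N%:R).
  move=> N0; have sL : 0 <= s * L <= L.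
    by rewrite mulr_ge0 ?(ltW L_gt0) //= ler_piMl // ltW.
  have := count N (s * L) N0 sL; rewrite rotation_count // mulfK //.
  have := count N L N0; rewrite countL lexx (ltW L_gt0) => /(_ isT).
  set d := _ - fract_sum z _ (y / L).
  set e1 := _ - _; set e2 := _ - _ => E1 E2.
  have -> : d = e2 - s * e1 by rewrite /e1 /e2; field.
  apply: le_trans (ler_normB _ _) _.
  have : `|s * e1| <= 1 * (2 * (C * (1 + ln N%:R))).
    by rewrite normrM ler_pM // ger0_norm.
  lra.
have lnS N : (0 < N)%N -> (N <= M)%N -> ln N%:R <= ln M%:R :> R.
  by move=> N0 NM; rewrite ler_ln ?posrE ?ltr0n // ler_nat.
have lnM0 : 0 <= ln M%:R :> R by rewrite ln_ge0 // ler1n.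
have [N MN] := rotation_time_near lA lB u M; rewrite -/time in MN.
have /andP[NT _] := rotation_time_bounds lA lB u N; rewrite -/time in NT.
have NM : (N <= M)%N by apply: leq_trans NT _; case: MN => ->.
have timesM : `|fract_sum z (time N) (y / L - s) -
    fract_sum z (time N) (y / L)| <= 4 * C * (1 + ln M%:R).
  have [N0|N0] := posnP N.
    rewrite N0 /time /rotation_time big_ord0 /fract_sum !big_ord0 subrr normr0.
    by rewrite mulr_ge0 ?mulr_ge0 // addr_ge0.
  apply: le_trans (times N N0) _.
  by rewrite ler_wpM2l ?mulr_ge0 // lerD2l lnS.
suff : `|fract_sum z M (y / L - s) - fract_sum z M (y / L)| <=
    4 * C * (1 + ln M%:R) + 1 by lra.
case: MN => ME; rewrite {1 2}ME; first by move: timesM; lra.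
rewrite -[(time N).+1]addn1 !fract_sumD /fract_sum !big_ord1 -!/(fract_sum _ _ _).
set x1 := fract _; set x2 := fract _.
rewrite opprD addrACA; apply: le_trans (ler_normD _ _) _.
have : `|x1 - x2| <= 1.
  rewrite ler_norml.
  have := fract_ge0 (y / L - s + (time N)%:R * z + 0%:R * z).
  have := fract_lt1 (y / L - s + (time N)%:R * z + 0%:R * z).
  have := fract_ge0 (y / L + (time N)%:R * z + 0%:R * z).
  have := fract_lt1 (y / L + (time N)%:R * z + 0%:R * z).
  by rewrite -/x1 -/x2 => *; apply/andP; split; lra.
move: timesM; lra.
Qed.

End Induced.

(** * From discrepancy to the mean, and the asymptotic statements *)

(** Averaging over s = i / M, i < M: by [sum_fract_rational] with p = -1 the mean
of fract (w - i / M) is 1 / 2 up to an error 1 / (2 M), so only the deviation of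
the sum of the fract (k z) from M / 2 survives. *)
Lemma fract_sum_mean {R : realType} (z E : R) (M : nat) : (0 < M)%N ->
  (forall s, 0 <= s <= 1 -> `|fract_sum z M (- s) - fract_sum z M 0| <= E) ->
  `|fract_sum z M 0 - M%:R / 2| <= E + 2^-1.
Proof.
move=> M0 HE; have MR : 0 < M%:R :> R by rewrite ltr0n.
have avg (w : R) : \sum_(i < M) fract (w + i%:R * ((- 1)%:~R / M%:R)) =
    fract (M%:R * w) + (M%:R - 1) / 2.
  by rewrite sum_fract_rational // coprimeNz coprimezE coprime1n.
pose rest : R := \sum_(k < M) (fract (M%:R * (0 + k%:R * z)) - 2^-1).
have restP : `|rest| <= M%:R * 2^-1.
  apply: le_trans (ler_norm_sum _ _ _) _.
  rewrite mulr_natl -[M in leRHS]card_ord -sumr_const; apply: ler_sum => k _.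
  have := fract_ge0 (M%:R * (0 + k%:R * z)).
  have := fract_lt1 (M%:R * (0 + k%:R * z)).
  by rewrite ler_norml => *; apply/andP; split; lra.
have total : \sum_(i < M) (fract_sum z M (- (i%:R / M%:R)) - fract_sum z M 0) =
    rest - M%:R * (fract_sum z M 0 - M%:R / 2).
  rewrite sumrB sumr_const card_ord /fract_sum exchange_big /=.
  have -> : \sum_(k < M) \sum_(i < M) fract (- (i%:R / M%:R) + k%:R * z) =
      \sum_(k < M) ((fract (M%:R * (0 + k%:R * z)) - 2^-1) + M%:R / 2).
    apply: eq_bigr => k _.
    transitivity (fract (M%:R * (0 + k%:R * z)) + (M%:R - 1) / 2); last by lra.
    rewrite -avg; apply: eq_bigr => i _.
    by congr fract; rewrite mulrN1z; ring.
  rewrite big_split /= sumr_const card_ord -/rest.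
  rewrite -[(_ / 2) *+ M]mulr_natl -[(\sum_(k < M) _) *+ M]mulr_natl.
  by ring.
have totalP : `|\sum_(i < M)
    (fract_sum z M (- (i%:R / M%:R)) - fract_sum z M 0)| <= M%:R * E.
  apply: le_trans (ler_norm_sum _ _ _) _.
  rewrite mulr_natl -[M in leRHS]card_ord -sumr_const; apply: ler_sum => i _.
  apply: HE; rewrite divr_ge0 //= ler_pdivrMr // mul1r ler_nat.
  exact/ltnW/ltn_ord.
set d := fract_sum z M 0 - _ in total *.
rewrite -(ler_pM2l MR) -[M%:R in leLHS]ger0_norm // -normrM.
rewrite -(subKr rest (M%:R * d)) -total.
by apply: le_trans (ler_normB _ _) _; rewrite mulrDr addrC lerD.
Qed.

(** The O-bound with its unspecified initial segment is a bound for all N >= 1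
once ln N is replaced by 1 + ln N: finitely many N are absorbed in the
constant by the trivial bound N, and conversely 1 <= ln N / ln 2 for
N >= 2. *)
Lemma star_discrepancyP {R : realType} (a b : R) (S : nat -> R) :
  a < b -> (forall n, S n \in `[a, b[) ->
  (star_discrepancy a b S =O_\oo (fun N => N%:R^-1 * ln N%:R)) <->
  exists C, forall N t, (0 < N)%N -> a <= t <= b ->
    `|(visits S `[a, t[%classic N)%:R - N%:R * ((t - a) / (b - a))| <=
    C * (1 + ln N%:R).
Proof.
move=> ab S_in; have ba0 : 0 < b - a by rewrite subr_gt0.
have local N t : (0 < N)%N ->
    `|(visits S `[a, t[%classic N)%:R / N%:R - (t - a) / (b - a)| * N%:R =
    `|(visits S `[a, t[%classic N)%:R - N%:R * ((t - a) / (b - a))|.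
  move=> N0; have NR : 0 < N%:R :> R by rewrite ltr0n.
  rewrite -[X in _ * X = _](ger0_norm (ltW NR)) -normrM; congr `|_|.
  by field; rewrite !gt_eqF.
have crude N t : a <= t <= b ->
    `|(visits S `[a, t[%classic N)%:R - N%:R * ((t - a) / (b - a))| <= N%:R.
  move=> /andP[ta tb].
  have vN : (visits S `[a, t[%classic N)%:R <= N%:R :> R.
    by rewrite ler_nat -[leqRHS]card_ord max_card.
  have : 0 <= (t - a) / (b - a) <= 1.
    by rewrite divr_ge0 ?ler_pdivrMr ?mul1r ?lerD2r ?subr_ge0 // ltW.
  have v0 : 0 <= (visits S `[a, t[%classic N)%:R :> R by [].
  move=> /andP[r0 r1]; have : N%:R * ((t - a) / (b - a)) <= N%:R.
    by rewrite ler_piMr.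
  have : 0 <= N%:R * ((t - a) / (b - a)) by rewrite mulr_ge0.
  by rewrite ler_norml => *; apply/andP; split; lra.
pose D N := [set `|(visits S `[a, t[%classic N)%:R / N%:R - (t - a) / (b - a)|
  | t in `]a, b[%classic ].
have in_D N t : a < t < b ->
    `|(visits S `[a, t[%classic N)%:R / N%:R - (t - a) / (b - a)| \in D N.
  by move=> tab; apply/mem_set; exists t => //=; rewrite in_itv.
have mid : a < (a + b) / 2 < b by lra.
have supP N t : (0 < N)%N -> a < t < b ->
    `|(visits S `[a, t[%classic N)%:R / N%:R - (t - a) / (b - a)| <=
    star_discrepancy a b S N.
  move=> N0 tab; apply: ub_le_sup; last exact/set_mem/in_D.
  exists 1 => _ [s + <-]; rewrite /= in_itv /= => /andP[as_ sb].
  have NR : 0 < N%:R :> R by rewrite ltr0n.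
  by rewrite -(ler_pM2r NR) local // mul1r crude // !ltW.
split=> [/eqO_exP[C C0 [N1 _ HC]]|[C HC]].
  (* The supremum ranges over a < t < b; at both endpoints the deviation is 0. *)
  exists (C + N1%:R) => N t N0 /andP[ta tb].
  have lnN : 0 <= ln N%:R :> R by rewrite ln_ge0 // ler1n.
  have N1R : 0 <= N1%:R :> R by [].
  have p1 : 0 <= C * ln N%:R by rewrite mulr_ge0 // ltW.
  have p2 : 0 <= N1%:R * ln N%:R :> R by rewrite mulr_ge0.
  have [NN1|N1N] := ltnP N N1.
    apply: le_trans (crude N t _) _; first by rewrite ta.
    have : N%:R <= N1%:R :> R by rewrite ler_nat ltnW.
    lra.
  have NR : 0 < N%:R :> R by rewrite ltr0n.
  move: ta; rewrite le_eqVlt => /predU1P[<-|ta].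
    rewrite subrr mul0r mulr0 subr0 (_ : visits _ _ _ = 0%N).
      by rewrite normr0; lra.
    rewrite /visits eq_card0 // => n; rewrite !inE mem_setE in_itv /=.
    by apply/negbTE/negP => /andP[] /le_lt_trans lt_a /lt_a; rewrite ltxx.
  move: tb; rewrite le_eqVlt => /predU1P[->|tb].
    rewrite divff ?gt_eqF // mulr1 (_ : visits _ _ _ = N).
      by rewrite subrr normr0; lra.
    rewrite /visits -[RHS]card_ord; apply: eq_card => n.
    by rewrite !inE mem_setE S_in.
  have := HC N N1N; rewrite /= normrM normrV ?unitfE ?gt_eqF //.
  rewrite (ger0_norm lnN) gtr0_norm // => DN.
  have := supP N t N0; rewrite ta tb => /(_ isT) St.
  rewrite -local // -ler_pdivlMr //.
  apply: le_trans St _; apply: le_trans (ler_norm _) _.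
  apply: le_trans DN _; rewrite mulrCA mulrC.
  rewrite ler_pM2r ?invr_gt0 //; lra.
have ln2 : 0 < ln 2 :> R by rewrite ln_gt0 // ltr1n.
have C0 : 0 <= C.
  have := HC 1%N a isT; rewrite lexx (ltW ab) ln1 addr0 mulr1 => /(_ isT).
  exact: le_trans.
apply/eqO_exP; exists (C * ((ln 2)^-1 + 1) + 1).
  by rewrite ltr_wpDl // mulr_ge0 // addr_ge0 // invr_ge0 ltW.
exists 2%N => // N /= N2; have N0 : (0 < N)%N by apply: leq_trans N2.
have NR : 0 < N%:R :> R by rewrite ltr0n.
have lnN : ln 2 <= ln N%:R :> R by rewrite ler_ln ?posrE ?ltr0n // ler_nat.
have lnN0 : 0 < ln N%:R :> R by apply: lt_le_trans lnN.
have pos : 0 <= star_discrepancy a b S N.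
  exact: le_trans (normr_ge0 _) (supP N _ N0 mid).
rewrite (ger0_norm pos) normrM normrV ?unitfE ?gt_eqF // !gtr0_norm //.
apply: ge_sup; first by eexists; exact/set_mem/(in_D N _ mid).
move=> _ [t + <-]; rewrite /= in_itv /= => /andP[ta tb].
rewrite -(ler_pM2r NR) local //.
apply: le_trans (HC N t N0 _) _; first by rewrite !ltW.
set K := _ + 1; have -> : K * (N%:R^-1 * ln N%:R) * N%:R = K * ln N%:R.
  by field; rewrite gt_eqF.
rewrite {}/K.
apply: (@le_trans _ _ (C * ((ln 2)^-1 + 1) * ln N%:R)).
  rewrite -mulrA ler_wpM2l // mulrDl mul1r lerD2r mulrC ler_pdivlMr //.
  by rewrite mul1r.
by rewrite ler_pM2r // lerDl.
Qed.

Lemma bounded_quotient_average {R : realType} (z : R) : irrational z ->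
  [bounded quotient_average z m | m in [set m | (1 <= m)%N]] <->
  exists K : R, forall m, \sum_(j < m) (cf_digit z j.+1)%:R <= K * m%:R.
Proof.
move=> zirr.
have avgE m : (0 < m)%N ->
    quotient_average z m * m%:R = \sum_(j < m) (cf_digit z j.+1)%:R.
  move=> m0; rewrite /quotient_average divfK ?pnatr_eq0 -?lt0n //.
  rewrite big_add1 /= big_mkord; apply: eq_bigr => j _.
  by rewrite -cf_digitE // -pmulrn.
have PF : ProperFilter (globally [set m | (1 <= m)%N]).
  exact: (@globally_properfilter _ _ 1%N).
split=> [/ex_bound[K HK]|[K HK]].
  exists K => -[|m]; first by rewrite big_ord0 mulr0.
  rewrite -avgE // ler_wpM2r //.
  by apply: le_trans (ler_norm _) _; exact: (HK m.+1).
apply/ex_bound; exists K => m /= m0.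
have mR : 0 < m%:R :> R by rewrite ltr0n.
rewrite -(ler_pM2r mR) -[X in _ * X <= _](ger0_norm (ltW mR)) -normrM avgE //.
by rewrite ger0_norm ?sumr_ge0.
Qed.

Theorem theorem3p3 (R : realType) (lA lB lC : R)
    (hA : 0 < lA) (hB : 0 < lB) (hC : 0 < lC) :
  let lstar := lA + lB + lC in
  let f := iet (letter_data 1 2 3)%N (letter_data 3 2 1)%N
               (letter_data lA lB lC) in
  let z := (lB + lC) / (lstar + lB) in
  (forall y : R, y \in `[0, lstar[ ->
     low_discrepancy 0 lstar (fun n => iter n f y)) <->
  (irrational z /\
   [bounded quotient_average z m | m in [set m | (1 <= m)%N]]).
Proof.
move=> lstar f z.
have l0 : 0 < lstar by rewrite !addr_gt0.
have orbit_in (y : R) : 0 <= y < lstar -> forall n, iter n f y \in `[0, lstar[.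
  by move=> y_in n; rewrite in_itv; case: (orbit_rotation _ _ _ hA hB hC y y_in n).
split=> [LD|[zirr avg] y].
  have y0 : 0 <= (0 : R) < lstar by rewrite lexx.
  have [] := LD 0 ltac:(by rewrite in_itv /= y0).
  move=> _ /(star_discrepancyP _ _ _ l0 (orbit_in 0 y0))[C HC].
  have bound N : (0 < N)%N ->
      `|fract_sum z N 0 - N%:R / 2| <= (4 * C + 2) * (1 + ln N%:R).
    move=> N0; have lnN : 0 <= ln N%:R :> R by rewrite ln_ge0 // ler1n.
    apply: le_trans (fract_sum_mean _ ((4 * C + 1) * (1 + ln N%:R)) _ N0 _) _.
      move=> s s01; rewrite -[- s]add0r -[0](mul0r (lstar + lB)^-1).
      apply: (rotation_discrepancy _ _ _ hA hB hC 0 y0 C) => // {N0 lnN}N t N0 t0.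
      by have := HC N t N0 t0; rewrite !subr0 visitsE.
    lra.
  have zirr := discrepancy_irrational _ _ bound.
  split=> //; apply/(bounded_quotient_average _ zirr).
  exact: digit_average_bounded zirr bound.
rewrite in_itv /= => y_in; split; first exact: orbit_in.
apply/(star_discrepancyP _ _ _ l0 (orbit_in y y_in)).
have [K HK] := (bounded_quotient_average _ zirr).1 avg.
have [C HC] := fract_sum_discrepancy _ _ zirr HK.
have C0 : 0 <= C.
  by have := HC 1%N 0 0 isT; rewrite ln1 addr0 mulr1; apply: le_trans.
exists (2 * C * (1 + ln 2)) => N t N0 t01; rewrite !subr0.
have lnN : 0 <= ln N%:R :> R by rewrite ln_ge0 // ler1n.
have ln2 : 0 <= ln 2 :> R by rewrite ln_ge0 // ler1n.
rewrite (visitsE _ _ _ hA hB hC y y_in).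
apply: le_trans (visit_count_discrepancy _ _ _ hA hB hC y y_in C HC N t N0 t01) _.
rewrite -[leRHS]mulrA ler_wpM2l ?mulr_ge0 //.
have : 0 <= ln 2 * ln N%:R :> R by rewrite mulr_ge0.
lra.
Qed.
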